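(* Let $n$ and $j$ be positive integers. Then \[ \sum_{\substack{0\le k\le n\\ n-k \text{ even}}} \binom{n}{k}\big(2^k L_{jk}-2L_j^k\big)(\sqrt5 F_j)^{n-k}\frac{B_{n-k+2}}{n-k+2}=\frac{2^{n+2}L_{j(n+2)}-2L_j^{n+2}}{5(n+1)(n+2)F_j^2}-L_j^n, \] \[ \sum_{\substack{0\le k\le n\\ n-k \text{ even}}} \binom{n}{k}\big(2^k L_{jk}+2L_j^k\big)(\sqrt5 F_j)^{n-k}\frac{2^{n-k+2}-1}{n-k+2}B_{n-k+2}=L_j^n, \] and \[ \sum_{\substack{0\le k\le n\\ n-k \text{ even}}} \binom{n}{k}2^k F_{jk}(\sqrt5F_j)^{n-k}\frac{B_{n-k+2}}{n-k+2}+\frac{2}{\sqrt5}\sum_{\substack{0\le k\le n-1\\ n-k \text{ odd}}}\binom{n}{k}L_j^k(\sqrt5F_j)^{n-k}\frac{B_{n-k+1}}{n-k+1} =\frac{2^{n+2}F_{j(n+2)}}{5(n+1)(n+2)F_j^2}-\frac{2L_j^{n+1}}{5(n+1)F_j}. \]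
   Context: $F_n$ and $L_n$ denote the Fibonacci and Lucas numbers: $F_0=0,F_1=1$, $L_0=2,L_1=1$, and $u_n=u_{n-1}+u_{n-2}$. The Bernoulli numbers $B_n$ are defined by $\sum_{n\ge0}B_n\frac{z^n}{n!}=\frac{z}{e^z-1}$ (so $B_0=1$, $B_1=-\tfrac12$, $B_2=\tfrac16$, $B_{2n+1}=0$ for $n\ge1$). *)

(* Defs.v *)
From mathcomp Require Import all_boot all_order all_algebra.

Set Implicit Arguments.
Unset Strict Implicit.
Unset Printing Implicit Defensive.

Import GRing.Theory.

Local Open Scope ring_scope.

Fixpoint fib (n : nat) : nat :=
  match n with
  | 0 => 0
  | 1 => 1
  | (m.+1 as p).+1 => fib p + fib m
  end%N.

Fixpoint lucas (n : nat) : nat :=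
  match n with
  | 0 => 2
  | 1 => 1
  | (m.+1 as p).+1 => lucas p + lucas m
  end%N.

(* Formal power series over rat are represented by their coefficient
   sequences. *)

Definition fps_mul (f g : nat -> rat) (n : nat) : rat :=
  \sum_(i < n.+1) f i * g (n - i)%N.

Definition fps_egf (a : nat -> rat) (n : nat) : rat := a n / n`!%:R.

Definition fps_X (n : nat) : rat := (n == 1%N)%:R.

(* e^z - 1 *)
Definition fps_expm1 (n : nat) : rat := if n is 0 then 0 else n`!%:R^-1.

(* [fps_inv_seq f n] lists the coefficients of degree 0, ..., n of 1 / f;
   it is meaningful only when f 0 != 0. *)
Fixpoint fps_inv_seq (f : nat -> rat) (n : nat) : seq rat :=
  if n is m.+1 then
    let s := fps_inv_seq f m in
    rcons s (- (f 0%N)^-1 * \sum_(i < m.+1) s`_i * f (m.+1 - i)%N)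
  else [:: (f 0%N)^-1].

Definition fps_inv (f : nat -> rat) (n : nat) : rat := (fps_inv_seq f n)`_n.

(* z / (e^z - 1) is the inverse of (e^z - 1) / z, whose coefficients are those
   of e^z - 1 shifted by one; B_n is n! times the n-th coefficient. The
   defining identity is [bernoulli_gf], and [bernoulli_unique] states that it
   determines the sequence. *)
Definition bernoulli (n : nat) : rat :=
  n`!%:R * fps_inv (fun m => fps_expm1 m.+1) n.

Lemma size_fps_inv_seq f n : size (fps_inv_seq f n) = n.+1.
Proof. by elim: n => //= n IHn; rewrite size_rcons IHn. Qed.

Lemma nth_fps_inv_seq f n i : (i <= n)%N -> (fps_inv_seq f n)`_i = fps_inv f i.
Proof.
elim: n => [|n IHn]; first by rewrite leqn0 => /eqP ->.
rewrite leq_eqVlt => /predU1P [-> // | lt_in] /=.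
by rewrite nth_rcons size_fps_inv_seq lt_in IHn.
Qed.

Lemma fps_invS f n :
  fps_inv f n.+1 =
    - (f 0%N)^-1 * \sum_(i < n.+1) fps_inv f i * f (n.+1 - i)%N.
Proof.
rewrite {1}/fps_inv /= nth_rcons size_fps_inv_seq ltnn eqxx.
congr (_ * _); apply: eq_bigr => i _.
by rewrite nth_fps_inv_seq // -ltnS.
Qed.

Lemma fps_mulVf f n : f 0%N != 0 -> fps_mul (fps_inv f) f n = (n == 0%N)%:R.
Proof.
move=> f0; rewrite /fps_mul; case: n => [|n].
  by rewrite big_ord_recl big_ord0 addr0 /= mulVf.
by rewrite big_ord_recr /= subnn fps_invS mulrAC mulNr mulVf // mulN1r subrr.
Qed.

Lemma fact_rat_neq0 n : n`!%:R != 0 :> rat.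
Proof. by rewrite Num.Theory.pnatr_eq0 -lt0n fact_gt0. Qed.

Lemma fps_egf_bernoulli n :
  fps_egf bernoulli n = fps_inv (fun m => fps_expm1 m.+1) n.
Proof. by rewrite /fps_egf /bernoulli mulrC mulKf // fact_rat_neq0. Qed.

Lemma bernoulli_gf : fps_mul (fps_egf bernoulli) fps_expm1 =1 fps_X.
Proof.
case=> [|n]; first by rewrite /fps_mul big_ord_recl big_ord0 mulr0 addr0.
transitivity (fps_mul (fps_inv (fun m => fps_expm1 m.+1))
                      (fun m => fps_expm1 m.+1) n); last first.
  by rewrite fps_mulVf // /fps_expm1 invr1 oner_eq0.
rewrite /fps_mul big_ord_recr [X in _ + X = _]/= subnn mulr0 addr0.
apply: eq_bigr => i _; rewrite fps_egf_bernoulli.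
by rewrite [nat_of_ord (widen_ord _ _)]/= subSn // -ltnS.
Qed.

Lemma bernoulli_unique (b : nat -> rat) :
  fps_mul (fps_egf b) fps_expm1 =1 fps_X -> b =1 bernoulli.
Proof.
move=> Hb n; have [m] := ubnP n; elim: m n => // m IHm n le_nm.
have := Hb n.+1; rewrite -(bernoulli_gf n.+1) /fps_mul.
rewrite big_ord_recr [in RHS]big_ord_recr /= subnn !mulr0 !addr0.
rewrite big_ord_recr [in RHS]big_ord_recr /= subSn // subnn.
under eq_bigr => i _.
  rewrite /fps_egf (IHm i); last exact: leq_trans (ltn_ord i) le_nm.
  over.
move/addrI; rewrite /= invr1 !mulr1.
by apply: mulIf; rewrite invr_eq0 fact_rat_neq0.
Qed.

(* Main.v *)
From HB Require Import structures.
Require Import Defs.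
From mathcomp Require Import all_boot all_order all_algebra.
From mathcomp Require Import ring lra.

Set Implicit Arguments.
Unset Strict Implicit.
Unset Printing Implicit Defensive.

Import GRing.Theory Num.Theory.

Local Open Scope ring_scope.

(* Let l_s be the linear functional on polynomials with l_s(X^m) = s^m B_m.  It
   satisfies l_s(p(X + s)) = l_s(p) + s p'(0), and this difference equation
   determines it; hence the vanishing of the odd Bernoulli numbers and the
   duplication formula l_2s(p) + l_2s(p(X + s)) = 2 l_s(p).  Put
   P_N(y) = l_s((X + y)^N) and
   Q_n(y) = \sum_m binom(n, m) y^(n - m) s^m B_(m+2) / (m+2); then
     (n+1) (n+2) s^2 Q_n(y)
       = (n+1) P_(n+2)(y) - (n+2) y P_(n+1)(y) + y^(n+2).
   With x = L_j and s = sqrt 5 F_j, Binet's formula gives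
   2^k L_(jk) = (x + s)^k + (x - s)^k, and
   sqrt 5 2^k F_(jk) = (x + s)^k - (x - s)^k, so the three sums are combinations
   of values of Q_n (and P_(n+1)) at x - s, x and x + s, which the difference
   equation evaluates. *)

(** * Linear functionals on polynomials *)

Lemma scalar_ext (R : numFieldType) (f g : {poly R} -> R) :
  scalar f -> scalar g -> (forall n, f 'X^n = g 'X^n) -> f =1 g.
Proof.
move=> fL gL fg p.
have h0 (h : {poly R} -> R) : scalar h -> h 0 = 0.
  by move=> hL; have := hL (-1) 0 0; rewrite scaler0 addr0 mulN1r addNr.
have hD (h : {poly R} -> R) : scalar h -> forall m,
    h (\sum_(i < m) p`_i *: 'X^i) = \sum_(i < m) p`_i * h 'X^i.
  move=> hL; elim=> [|m IH]; first by rewrite !big_ord0 h0.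
  by rewrite !big_ord_recr /= addrC hL IH addrC.
rewrite -[p]coefK poly_def !hD //.
by apply: eq_bigr => i _; rewrite fg.
Qed.

Definition umbral (R : numFieldType) (a : nat -> R) (p : {poly R}) : R :=
  \sum_(i < size p) p`_i * a i.

Lemma umbral_widen (R : numFieldType) (a : nat -> R) (p : {poly R}) m :
  (size p <= m)%N -> umbral a p = \sum_(i < m) p`_i * a i.
Proof.
move=> le_pm; rewrite /umbral (big_ord_widen m (fun i => p`_i * a i)) //.
rewrite big_mkcond; apply: eq_bigr => i _.
by case: ltnP => // le_pi; rewrite nth_default ?mul0r.
Qed.

Lemma umbral_is_scalar (R : numFieldType) (a : nat -> R) : scalar (umbral a).
Proof.
move=> c p q; set m := maxn (size p) (size q).
have sp : (size p <= m)%N by rewrite leq_maxl.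
have sq : (size q <= m)%N by rewrite leq_maxr.
rewrite (umbral_widen a sp) (umbral_widen a sq) (@umbral_widen _ _ _ m).
  rewrite mulr_sumr -big_split /=; apply: eq_bigr => i _.
  by rewrite coefD coefZ mulrDl mulrA.
apply: leq_trans (size_polyD _ _) _; rewrite geq_max sq andbT.
exact: leq_trans (size_scale_leq _ _) sp.
Qed.

HB.instance Definition _ (R : numFieldType) (a : nat -> R) :=
  GRing.isLinear.Build R {poly R} R *%R (umbral a) (umbral_is_scalar a).

Lemma umbral_Xn (R : numFieldType) (a : nat -> R) n : umbral a 'X^n = a n.
Proof.
rewrite /umbral size_polyXn big_ord_recr big1 /= ?coefXn ?eqxx ?mul1r ?add0r //.
by move=> i _; rewrite coefXn ltn_eqF ?mul0r.
Qed.

Lemma umbral_XDn (R : numFieldType) (a : nat -> R) n y :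
  umbral a (('X + y%:P) ^+ n) = \sum_(m < n.+1) 'C(n, m)%:R * a m * y ^+ (n - m).
Proof.
rewrite addrC exprDn linear_sum; apply: eq_bigr => m _.
by rewrite -polyC_exp mul_polyC linearMn linearZ /= umbral_Xn -mulr_natl; ring.
Qed.

(** The difference [h] of the two functionals kills every p(X + s) - p. Since (X + s)^(n+1) -
    X^(n+1) has degree n and leading coefficient (n+1) s, which is nonzero, strong induction on n
    gives h(X^n) = 0. *)
Lemma shift_invariant_eq (R : numFieldType) (s : R) (f g : {poly R} -> R) :
    s != 0 -> scalar f -> scalar g ->
    (forall p, f (p \Po ('X + s%:P)) - f p = g (p \Po ('X + s%:P)) - g p) ->
  f =1 g.
Proof.
move=> s0 fL gL fg.
pose h p := f p - g p.
have hL : scalar h by move=> c p q; rewrite /h fL gL; ring.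
have [H hE] : exists H : {scalar {poly R}}, H =1 h.
  pose hM := GRing.isLinear.Build R {poly R} R *%R h hL.
  by exists (HB.pack_for {scalar {poly R}} h hM).
apply: scalar_ext => // n; apply/eqP; rewrite -subr_eq0 -[_ - _]hE; apply/eqP.
have [m] := ubnP n; elim: m n => // m IH n le_nm.
have : H ('X^(n.+1) \Po ('X + s%:P)) - H 'X^(n.+1) = 0.
  by have /eqP := fg 'X^(n.+1); rewrite -subr_eq0 !hE /h => /eqP <-; ring.
rewrite comp_Xn_poly ['X + _]addrC exprDn linear_sum.
rewrite big_ord_recr /= subnn expr0 mul1r binn mulr1n.
(* By induction only the terms in X^n and X^(n+1) of the expansion survive, and the latter
   cancels. *)
rewrite big_ord_recr /= big1 => [|i _]; last first.
  rewrite -polyC_exp mul_polyC linearMn linearZ /= IH ?mulr0 ?mul0rn //.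
  exact: leq_trans (ltn_ord i) le_nm.
rewrite add0r -polyC_exp mul_polyC linearMn linearZ /= subSnn binSn.
rewrite expr1 addrK => /eqP; rewrite mulrn_eq0 /= mulf_eq0 (negPf s0) /=.
by move/eqP.
Qed.

(** * The Bernoulli functional and its functional equations *)

(** Compare coefficients of z^n in [bernoulli_gf] and multiply by n!; the index i = n is absent
    because e^z - 1 has no constant term. *)
Lemma bernoulli_sum (R : numFieldType) n :
  \sum_(i < n) 'C(n, i)%:R * ratr (bernoulli i) = (n == 1)%:R :> R.
Proof.
have e : \sum_(i < n) 'C(n, i)%:R * bernoulli i = (n == 1)%:R :> rat.
  have := bernoulli_gf n; rewrite /fps_mul big_ord_recr /= subnn mulr0 addr0.
  rewrite /fps_X => /(congr1 (fun q => n`!%:R * q)).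
  rewrite mulr_sumr => e; transitivity (n`!%:R * (n == 1)%:R : rat).
    rewrite -{}e; apply: eq_bigr => i _.
    rewrite /fps_egf -(bin_fact (ltnW (ltn_ord i))) !natrM.
    have ini : (0 < n - i)%N by rewrite subn_gt0.
    case: (n - i)%N ini => // k _ /=.
    by field; rewrite !fact_rat_neq0.
  by case: eqP => [->|]; rewrite ?mulr1 ?mulr0.
rewrite -[RHS](ratr_nat R) -e rmorph_sum; apply: eq_bigr => i _ /=.
by rewrite [RHS]rmorphM /= ratr_nat.
Qed.

(** This is l_s. For nonzero s its value at (X + y)^N is the scaled Bernoulli polynomial s^N B_N(y /
    s). *)
Definition bernoulli_umbral (R : numFieldType) (s : R) : {poly R} -> R :=
  umbral (fun m => s ^+ m * ratr (bernoulli m)).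

HB.instance Definition _ (R : numFieldType) (s : R) :=
  GRing.Linear.on (bernoulli_umbral s).

(** By linearity p = X^n suffices, and there the claim is [bernoulli_sum] scaled by s^n: the
    increment is s for n = 1 and 0 otherwise. *)
Lemma bernoulli_umbral_shift (R : numFieldType) (s : R) (p : {poly R}) :
  bernoulli_umbral s (p \Po ('X + s%:P)) = bernoulli_umbral s p + s * p^`().[0].
Proof.
move: p; apply: scalar_ext => [c p q|c p q|n].
- by rewrite comp_polyD comp_polyZ linearP.
- by rewrite derivD derivZ hornerD hornerZ linearP /=; ring.
rewrite /bernoulli_umbral comp_Xn_poly umbral_XDn umbral_Xn.
rewrite big_ord_recr /= binn subnn expr0 mulr1 mul1r addrC; congr (_ + _).
transitivity (s ^+ n * \sum_(i < n) 'C(n, i)%:R * ratr (bernoulli i)).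
  rewrite mulr_sumr; apply: eq_bigr => i _.
  by rewrite -[in s ^+ n](subnKC (ltnW (ltn_ord i))) exprD; ring.
rewrite bernoulli_sum derivXn hornerMn hornerXn.
by case: n => [|[|n]]; rewrite ?mulr0 ?mulr1 ?expr1 //= ?expr0n ?mul0rn ?mulr0.
Qed.

Lemma bernoulli_umbral_XDn (R : numFieldType) (s y : R) n :
  bernoulli_umbral s (('X + (y + s)%:P) ^+ n) =
    bernoulli_umbral s (('X + y%:P) ^+ n) + n%:R * s * y ^+ n.-1.
Proof.
have := bernoulli_umbral_shift s (('X + y%:P) ^+ n).
rewrite rmorphXn /= comp_polyD comp_polyX comp_polyC -addrA -polyCD.
rewrite [s + y]addrC => ->; congr (_ + _).
rewrite deriv_exp derivD derivX derivC addr0 mul1r hornerMn horner_exp.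
by rewrite hornerD hornerX hornerC add0r -mulr_natl; ring.
Qed.

(* Both sides solve the same difference equation. *)
Lemma bernoulli_umbral_reflect (R : numFieldType) (s : R) (p : {poly R}) :
  s != 0 ->
  bernoulli_umbral s (p \Po (- 'X - s%:P)) = bernoulli_umbral s p.
Proof.
move=> s0; move: p; apply: (shift_invariant_eq s0) => [c p q|c p q|p].
- by rewrite comp_polyD comp_polyZ linearP.
- by rewrite linearP.
rewrite bernoulli_umbral_shift -comp_polyA comp_polyD comp_polyX comp_polyC.
rewrite subrK.
have := bernoulli_umbral_shift s (p \Po (- 'X)).
rewrite -comp_polyA raddfN /= comp_polyX opprD => ->.
rewrite deriv_comp derivN derivX hornerM horner_comp !hornerE oppr0.
rewrite /= mulrN1; ring.
Qed.

(** For s = 1, reflecting (-X)^n gives l_1((X + 1)^n) = -B_n, while the shift rule gives l_1((X +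
    1)^n) = B_n, as the derivative of X^n vanishes at 0 for n > 1. *)
Lemma bernoulli_odd n : odd n -> n != 1%N -> bernoulli n = 0.
Proof.
move=> on n1; have := bernoulli_umbral_reflect ((- 'X) ^+ n) (oner_neq0 rat).
rewrite rmorphXn /= raddfN /= comp_polyX opprD !opprK.
have := bernoulli_umbral_shift 1 ('X^n : {poly rat}).
rewrite comp_Xn_poly => ->.
rewrite exprNn -signr_odd on expr1 mulN1r linearN /=.
rewrite [bernoulli_umbral _ _]umbral_Xn expr1n !mul1r derivXn hornerMn hornerXn.
case: n on n1 => [|[|n]] // _ _; rewrite expr0n mul0rn addr0.

move=> e; have /eqP : ratr (bernoulli n.+2) = 0 :> rat by lra.
by rewrite fmorph_eq0 => /eqP.
Qed.

(* Both sides solve the same difference equation. *)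
Lemma bernoulli_umbral_duplication (R : numFieldType) (s : R) (p : {poly R}) :
  s != 0 ->
  bernoulli_umbral (2 * s) p + bernoulli_umbral (2 * s) (p \Po ('X + s%:P)) =
    2 * bernoulli_umbral s p.
Proof.
move=> s0; move: p; apply: (shift_invariant_eq s0) => [c p q|c p q|p].
- by rewrite comp_polyD comp_polyZ !linearP /=; ring.
- by rewrite linearP /=; ring.
rewrite [in RHS]bernoulli_umbral_shift -comp_polyA comp_polyD comp_polyX.
rewrite comp_polyC.
have -> : 'X + s%:P + s%:P = 'X + (2 * s)%:P by rewrite -addrA -polyCD mulr_natl.
by rewrite bernoulli_umbral_shift; ring.
Qed.

Lemma bernoulli_umbral_duplication_XDn (R : numFieldType) (s y : R) n :
  s != 0 ->
  bernoulli_umbral (2 * s) (('X + y%:P) ^+ n)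
    + bernoulli_umbral (2 * s) (('X + (y + s)%:P) ^+ n) =
  2 * bernoulli_umbral s (('X + y%:P) ^+ n).
Proof.
move=> s0; rewrite -bernoulli_umbral_duplication //.
congr (_ + bernoulli_umbral _ _).
by rewrite rmorphXn /= comp_polyD comp_polyX comp_polyC -addrA -polyCD [s + y]addrC.
Qed.

(** * The sums Q_n and their expression through P_N *)

Definition bernoulli_conv (R : numFieldType) (s : R) n (y : R) : R :=
  \sum_(m < n.+1) 'C(n, m)%:R * y ^+ (n - m) * s ^+ m
    * (ratr (bernoulli (m + 2)) / (m + 2)%:R).

(** Put m = n - k; the terms of Q_n with m odd vanish, since m + 2 is then odd and at least 3. *)
Lemma bernoulli_conv_even (R : numFieldType) (s : R) n (y : R) :
  \sum_(k < n.+1 | ~~ odd (n - k)) 'C(n, k)%:R * y ^+ k * s ^+ (n - k)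
    * (ratr (bernoulli (n - k + 2)) / (n - k + 2)%:R) = bernoulli_conv s n y.
Proof.
rewrite big_mkcond (reindex_inj rev_ord_inj); apply: eq_bigr => m _ /=.
have le_mn : (m <= n)%N by rewrite -ltnS.
rewrite subSS subKn // bin_sub //; case: ifP => //= /negbFE om.
by rewrite bernoulli_odd ?rmorph0 ?mul0r ?mulr0 ?addn2 //= negbK.
Qed.

Lemma ratr_bernoulli0 (R : numFieldType) : ratr (bernoulli 0) = 1 :> R.
Proof. by have := bernoulli_sum R 1; rewrite big_ord1 bin0 mul1r. Qed.

Lemma ratr_bernoulli1 (R : numFieldType) : ratr (bernoulli 1) = - 2^-1 :> R.
Proof.
have := bernoulli_sum R 2; rewrite big_ord_recr big_ord1 /= bin0 bin1 mul1r.
rewrite ratr_bernoulli0 => /eqP; rewrite addrC addr_eq0 => /eqP e.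
by apply: (@mulfI _ 2); rewrite ?pnatr_eq0 // e mulrN divff ?pnatr_eq0.
Qed.

Lemma bernoulli_umbral_XDnS (R : numFieldType) (s y : R) n :
  bernoulli_umbral s (('X + y%:P) ^+ n.+1) =
    y ^+ n.+1 - n.+1%:R * s * y ^+ n / 2
    + \sum_(m < n) 'C(n.+1, m.+2)%:R * s ^+ m.+2 * ratr (bernoulli m.+2)
        * y ^+ (n - m.+1).
Proof.
rewrite /bernoulli_umbral umbral_XDn !big_ord_recl /= addrA; congr (_ + _).
  rewrite bin0 bin1 ratr_bernoulli0 [bump 0 0]/= ratr_bernoulli1 subn0 subSS subn0.
  by rewrite expr0 expr1; ring.
by apply: eq_bigr => i _ /=; rewrite /bump /= !add1n subSS; ring.
Qed.

(** The terms of P_(n+2) and P_(n+1) with B_0 and B_1 contribute -y^(n+2) in total. The others match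
    coefficientwise, by (n+1) (n+2) binom(n, m) / (m+2) = (n+1) binom(n+2, m+2) - (n+2) binom(n+1,
    m+2). *)
Lemma bernoulli_convE (R : numFieldType) (s : R) n (y : R) :
  n.+1%:R * n.+2%:R * s ^+ 2 * bernoulli_conv s n y =
    n.+1%:R * bernoulli_umbral s (('X + y%:P) ^+ n.+2)
    - n.+2%:R * y * bernoulli_umbral s (('X + y%:P) ^+ n.+1) + y ^+ n.+2.
Proof.
rewrite !bernoulli_umbral_XDnS.
set S1 := \sum_(m < n.+1) _; set S2 := \sum_(m < n) _.
have yS2 : y * S2 = \sum_(m < n.+1) 'C(n.+1, m.+2)%:R * s ^+ m.+2
                     * ratr (bernoulli m.+2) * y ^+ (n - m).
  (* The added term m = n is zero because binom(n+1, n+2) = 0. *)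
  rewrite big_ord_recr /= bin_small // !mul0r addr0 mulr_sumr.
  by apply: eq_bigr => i _; rewrite -(subnSK (ltn_ord i)) [y ^+ _.+1]exprS; ring.
transitivity (n.+1%:R * S1 - n.+2%:R * (y * S2)); last first.
  by rewrite !exprS; ring.
rewrite yS2 !mulr_sumr -sumrB; apply: eq_bigr => m _.
rewrite subSS addn2.
have e1 : m.+2%:R * 'C(n.+2, m.+2)%:R = n.+2%:R * 'C(n.+1, m.+1)%:R :> R.
  by rewrite -!natrM mul_bin_diag.
have e2 : m.+1%:R * 'C(n.+1, m.+1)%:R = n.+1%:R * 'C(n, m)%:R :> R.
  by rewrite -!natrM mul_bin_diag.
have e3 : 'C(n.+2, m.+2)%:R = 'C(n.+1, m.+2)%:R + 'C(n.+1, m.+1)%:R :> R.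
  by rewrite -natrD binS.
set X := 'C(n.+1, m.+1)%:R in e1 e2 e3.
have m2 : m.+2%:R != 0 :> R by rewrite pnatr_eq0.
suff e : n.+1%:R * n.+2%:R * 'C(n, m)%:R / m.+2%:R =
  n.+1%:R * 'C(n.+2, m.+2)%:R - n.+2%:R * 'C(n.+1, m.+2)%:R :> R.
  transitivity ((n.+1%:R * n.+2%:R * 'C(n, m)%:R / m.+2%:R)
    * y ^+ (n - m) * s ^+ m.+2 * ratr (bernoulli m.+2)); last by rewrite e; ring.
  by rewrite !exprS; ring.
apply: (mulIf m2); rewrite divfK //.
have -> : 'C(n.+1, m.+2)%:R = 'C(n.+2, m.+2)%:R - X by rewrite e3 addrK.
have -> : n.+1%:R * n.+2%:R * 'C(n, m)%:R = n.+2%:R * (m.+1%:R * X).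
  by rewrite e2; ring.
transitivity ((n.+1%:R - n.+2%:R) * (m.+2%:R * 'C(n.+2, m.+2)%:R)
   + n.+2%:R * m.+2%:R * X); last by ring.
by rewrite e1 -[n.+2]addn1 -[m.+2]addn1 !natrD; ring.
Qed.

(** With k = n - 1 - m and (n+1) binom(n, m+1) = (m+2) binom(n+1, m+2), the left side is P_(n+1)(y)
    without its B_0 and B_1 terms; the even values of n - k add only vanishing odd Bernoulli
    numbers. *)
Lemma bernoulli_conv_odd (R : numFieldType) (s : R) n (y : R) :
  n.+1%:R * s * (\sum_(k < n | odd (n - k)) 'C(n, k)%:R * y ^+ k * s ^+ (n - k)
    * (ratr (bernoulli (n - k + 1)) / (n - k + 1)%:R)) =
  bernoulli_umbral s (('X + y%:P) ^+ n.+1) - y ^+ n.+1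
    + n.+1%:R * s * y ^+ n / 2.
Proof.
rewrite bernoulli_umbral_XDnS; set S := (X in _ + X - _ + _).
transitivity S; last by ring.
rewrite big_mkcond (reindex_inj rev_ord_inj) mulr_sumr; apply: eq_bigr => m _ /=.
rewrite subKn // bin_sub // addn1.
have [om|/negbNE em] := boolP (odd m.+1); last first.
  by rewrite bernoulli_odd ?rmorph0 ?mulr0 ?mul0r //= negbK.
have e : 'C(n.+1, m.+2)%:R * m.+2%:R = n.+1%:R * 'C(n, m.+1)%:R :> R.
  by rewrite mulrC -!natrM mul_bin_diag.
have m2 : m.+2%:R != 0 :> R by rewrite pnatr_eq0.
rewrite -[X in _ = X * _ * _ * _](mulfK m2) e [s ^+ m.+2]exprS; ring.
Qed.

(** * Combinations of Q_n at x - s, x and x + s *)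

Lemma bernoulli_conv_second_difference (R : numFieldType) (s x : R) n :
  s != 0 ->
  bernoulli_conv s n (x + s) + bernoulli_conv s n (x - s)
    - 2 * bernoulli_conv s n x =
  ((x + s) ^+ n.+2 + (x - s) ^+ n.+2 - 2 * x ^+ n.+2)
    / (n.+1%:R * n.+2%:R * s ^+ 2) - x ^+ n.
Proof.
move=> s0; have U0 : n.+1%:R * n.+2%:R * s ^+ 2 != 0.
  by rewrite !mulf_neq0 ?expf_neq0 ?pnatr_eq0.
apply: (mulfI U0); rewrite [RHS]mulrBr [in RHS]mulrC divfK //.
rewrite mulrBr mulrDr [_ * (2 * _)]mulrCA !bernoulli_convE.
(* All values of P_N are brought to x - s; those of P_(n+1) then cancel because (x + s) + (x - s) -
   2 x = 0. *)
have shift m := bernoulli_umbral_XDn s (x - s) m; rewrite subrK in shift.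
rewrite !bernoulli_umbral_XDn !shift /= !exprS; ring.
Qed.

Lemma bernoulli_conv_difference (R : numFieldType) (s x : R) n :
  n.+1%:R * n.+2%:R * s ^+ 2
    * (bernoulli_conv s n (x + s) - bernoulli_conv s n (x - s)) =
  (x + s) ^+ n.+2 - (x - s) ^+ n.+2 - n.+1%:R * n.+2%:R * s ^+ 2 * x ^+ n
    - 2 * n.+2%:R * s * bernoulli_umbral s (('X + x%:P) ^+ n.+1).
Proof.
rewrite mulrBr !bernoulli_convE.
have shift m := bernoulli_umbral_XDn s (x - s) m; rewrite subrK in shift.
rewrite !bernoulli_umbral_XDn !shift /= !exprS; ring.
Qed.

(** The combination produces the factor 2^(m+2) - 1, as 4 (2 s)^m - s^m = (2^(m+2) - 1) s^m. For
    step 2 s, the points x - s and x + s are one step apart, and the duplication formula relates x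
    to x - s. *)
Lemma bernoulli_conv_duplication (R : numFieldType) (s x : R) n :
  s != 0 ->
  4 * (bernoulli_conv (2 * s) n (x + s) + bernoulli_conv (2 * s) n (x - s)
       + 2 * bernoulli_conv (2 * s) n x)
  - (bernoulli_conv s n (x + s) + bernoulli_conv s n (x - s)
     + 2 * bernoulli_conv s n x) = x ^+ n.
Proof.
move=> s0; have U0 : n.+1%:R * n.+2%:R * s ^+ 2 != 0.
  by rewrite !mulf_neq0 ?expf_neq0 ?pnatr_eq0.
apply: (mulfI U0).
pose q (c y : R) := n.+1%:R * n.+2%:R * c ^+ 2 * bernoulli_conv c n y.
(* The factor 4 is absorbed into (2 s)^2. *)
transitivity (q (2 * s) (x + s) + q (2 * s) (x - s) + 2 * q (2 * s) x
              - (q s (x + s) + q s (x - s) + 2 * q s x)).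
  by rewrite /q; ring.
rewrite /q !bernoulli_convE.
have shift m := bernoulli_umbral_XDn s (x - s) m; rewrite subrK in shift.
have shift2 m := bernoulli_umbral_XDn (2 * s) (x - s) m.
have -> : x + s = x - s + 2 * s by ring.
have dup m : bernoulli_umbral (2 * s) (('X + x%:P) ^+ m) =
    2 * bernoulli_umbral s (('X + (x - s)%:P) ^+ m)
    - bernoulli_umbral (2 * s) (('X + (x - s)%:P) ^+ m).
  by rewrite -bernoulli_umbral_duplication_XDn // subrK addrAC subrr add0r.
rewrite !shift2 !dup.
have -> : x - s + 2 * s = x + s by ring.
rewrite !bernoulli_umbral_XDn !shift /= !exprS; ring.
Qed.

(** * Binet's formulas *)

Lemma fib_rec k : fib k.+2 = (fib k.+1 + fib k)%N. Proof. by []. Qed.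

Lemma lucas_rec k : lucas k.+2 = (lucas k.+1 + lucas k)%N. Proof. by []. Qed.

Lemma fib_gt0 k : (0 < fib k.+1)%N.
Proof. by elim: k => // k IH; rewrite fib_rec addn_gt0 IH. Qed.

Lemma linear_rec2_eq (R : numFieldType) (u v : nat -> R) :
    (forall k, u k.+2 = u k.+1 + u k) -> (forall k, v k.+2 = v k.+1 + v k) ->
    u 0%N = v 0%N -> u 1%N = v 1%N ->
  u =1 v.
Proof.
move=> urec vrec e0 e1 k; suff [] : u k = v k /\ u k.+1 = v k.+1 by [].
by elim: k => // k [IH1 IH2]; split; rewrite ?urec ?vrec ?IH1 ?IH2.
Qed.

Lemma binet (R : rcfType) (r : R) k (phi := (1 + r) / 2) (psi := (1 - r) / 2) :
  r ^+ 2 = 5 ->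
  (lucas k)%:R = phi ^+ k + psi ^+ k /\ r * (fib k)%:R = phi ^+ k - psi ^+ k.
Proof.
move=> r5.
have rec (z : R) : z ^+ 2 = z + 1 -> forall m, z ^+ m.+2 = z ^+ m.+1 + z ^+ m.
  by move=> ez m; rewrite -[m.+2]addn2 exprD ez [z ^+ m.+1]exprS; ring.
have phi_rec : forall m, phi ^+ m.+2 = phi ^+ m.+1 + phi ^+ m.
  apply: rec; have -> : phi ^+ 2 = (1 + 2 * r + r ^+ 2) / 4 by rewrite /phi; field.
  by rewrite r5 /phi; field.
have psi_rec : forall m, psi ^+ m.+2 = psi ^+ m.+1 + psi ^+ m.
  apply: rec; have -> : psi ^+ 2 = (1 - 2 * r + r ^+ 2) / 4 by rewrite /psi; field.
  by rewrite r5 /psi; field.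
split; move: k.
  apply: linear_rec2_eq => [k|k||]; rewrite ?lucas_rec ?natrD ?phi_rec ?psi_rec //.
  - by ring.
  - by rewrite /= !expr1 /phi /psi; field.
apply: linear_rec2_eq => [k|k||]; rewrite ?fib_rec ?natrD ?phi_rec ?psi_rec //.
- by ring.
- by ring.
- by rewrite /= !expr0; ring.
- by rewrite /= !expr1 /phi /psi; field.
Qed.

(** Here x + s = 2 phi^j and x - s = 2 psi^j. *)
Lemma binet_multiple (R : rcfType) (r : R) j k
    (x := (lucas j)%:R) (s := r * (fib j)%:R) :
  r ^+ 2 = 5 ->
  2 ^+ k * (lucas (j * k))%:R = (x + s) ^+ k + (x - s) ^+ k /\
  r * (2 ^+ k * (fib (j * k))%:R) = (x + s) ^+ k - (x - s) ^+ k.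
Proof.
move=> r5; have [eL eF] := binet j r5; have [eLk eFk] := binet (j * k) r5.
rewrite /x /s eL eF [r * (_ * _)]mulrCA eLk eFk !exprM.
set a := (_ / 2) ^+ j; set b := (_ / 2) ^+ j.
have -> : a + b + (a - b) = 2 * a by ring.
have -> : a + b - (a - b) = 2 * b by ring.
by rewrite !exprMn mulrDr mulrBr.
Qed.

(** * The three Fibonacci-Lucas identities *)

Theorem theorem2 (R : rcfType) (n j : nat) (hn : (0 < n)%N) (hj : (0 < j)%N) :
  [/\ \sum_(k < n.+1 | ~~ odd (n - k))
         'C(n, k)%:R
         * (2 ^+ k * (lucas (j * k))%:R - 2 * (lucas j)%:R ^+ k)
         * (Num.sqrt 5 * (fib j)%:R) ^+ (n - k)
         * (ratr (bernoulli (n - k + 2)) / (n - k + 2)%:R)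
      = (2 ^+ (n + 2) * (lucas (j * (n + 2)))%:R - 2 * (lucas j)%:R ^+ (n + 2))
          / (5 * (n + 1)%:R * (n + 2)%:R * (fib j)%:R ^+ 2)
        - (lucas j)%:R ^+ n :> R,
      \sum_(k < n.+1 | ~~ odd (n - k))
         'C(n, k)%:R
         * (2 ^+ k * (lucas (j * k))%:R + 2 * (lucas j)%:R ^+ k)
         * (Num.sqrt 5 * (fib j)%:R) ^+ (n - k)
         * ((2 ^+ (n - k + 2) - 1) / (n - k + 2)%:R)
         * ratr (bernoulli (n - k + 2))
      = (lucas j)%:R ^+ n :> R
    & \sum_(k < n.+1 | ~~ odd (n - k))
         'C(n, k)%:R
         * 2 ^+ k * (fib (j * k))%:R
         * (Num.sqrt 5 * (fib j)%:R) ^+ (n - k)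
         * (ratr (bernoulli (n - k + 2)) / (n - k + 2)%:R)
      + 2 / Num.sqrt 5
        * \sum_(k < n | odd (n - k))
             'C(n, k)%:R
             * (lucas j)%:R ^+ k
             * (Num.sqrt 5 * (fib j)%:R) ^+ (n - k)
             * (ratr (bernoulli (n - k + 1)) / (n - k + 1)%:R)
      = 2 ^+ (n + 2) * (fib (j * (n + 2)))%:R
          / (5 * (n + 1)%:R * (n + 2)%:R * (fib j)%:R ^+ 2)
        - 2 * (lucas j)%:R ^+ (n + 1) / (5 * (n + 1)%:R * (fib j)%:R) :> R].
Proof.
set r : R := Num.sqrt 5; have r5 : r ^+ 2 = 5 by rewrite sqr_sqrtr ?ler0n.
have r0 : r != 0 by rewrite -sqrf_eq0 r5 pnatr_eq0.
set x : R := (lucas j)%:R; set s := r * (fib j)%:R.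
have f0 : (fib j)%:R != 0 :> R.
  by case: j hj {x s} => // j' _; rewrite pnatr_eq0 -lt0n fib_gt0.
have s0 : s != 0 by rewrite mulf_neq0.
have eL k : 2 ^+ k * (lucas (j * k))%:R = (x + s) ^+ k + (x - s) ^+ k.
  by have [] := binet_multiple j k r5.
have eF k : 2 ^+ k * (fib (j * k))%:R = ((x + s) ^+ k - (x - s) ^+ k) / r.
  by have [_ <-] := binet_multiple j k r5; rewrite [RHS]mulrAC divff ?mul1r.
have s2 : s ^+ 2 = 5 * (fib j)%:R ^+ 2 by rewrite exprMn r5.
split.
- transitivity (bernoulli_conv s n (x + s) + bernoulli_conv s n (x - s)
                - 2 * bernoulli_conv s n x).
    rewrite -!bernoulli_conv_even mulr_sumr -big_split /= -sumrB.
    by apply: eq_bigr => k _; rewrite eL; ring.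
  rewrite bernoulli_conv_second_difference // eL addn2 addn1 s2.
  by congr (_ / _ - _); ring.
- rewrite -[RHS](bernoulli_conv_duplication x n s0) -!bernoulli_conv_even.
  rewrite !mulr_sumr -!big_split /= !mulr_sumr -sumrB; apply: eq_bigr => k _.
  by rewrite eL [(2 * s) ^+ _]exprMn [2 ^+ (_ + 2)]exprD; ring.
- have U0 : n.+1%:R * n.+2%:R * s ^+ 2 != 0.
    by rewrite mulf_neq0 ?(expf_neq0 2 s0) // -natrM pnatr_eq0.
  apply: (mulfI r0); apply: (mulfI U0).
  have := bernoulli_conv_odd s n x; set S := \sum_(k < n | _) _ => eS.
  (* After scaling by sqrt 5 (n+1) (n+2) s^2, the even sum is a difference of values of Q_n, and its
     remaining P_(n+1)(x) cancels against the one in the odd sum. *)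
  transitivity (n.+1%:R * n.+2%:R * s ^+ 2
      * (bernoulli_conv s n (x + s) - bernoulli_conv s n (x - s))
    + 2 * n.+2%:R * s * (n.+1%:R * s * S)).
    rewrite -!bernoulli_conv_even -sumrB !mulrDr; congr (_ + _).
      congr (_ * _); rewrite mulr_sumr; apply: eq_bigr => k _.
      by rewrite -['C(n, k)%:R * _ * _]mulrA eF; set c := _ / (n - k + 2)%:R; field.
    by field.
  rewrite bernoulli_conv_difference eS eF !addn2 !addn1 s2 !exprS expr0 -r5 /s.
  by field; rewrite f0 r0 nat1r -natrD !pnatr_eq0.
Qed.
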